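(* Let $\{A,S(0,0),\Pi(0,0)\}$ be a triple of matrices, where $A$ and $S(0,0)$ are $n\times n$ and $\Pi(0,0)=\begin{bmatrix}\vartheta_1 & \vartheta_2\end{bmatrix}$ is $n\times m$ with $n\times h$ blocks $\vartheta_1,\vartheta_2$, satisfying $$AS(0,0)-S(0,0)A^*=\Pi(0,0)\,j\,\Pi(0,0)^*,\qquad S(0,0)=S(0,0)^*.$$ Let $Q$ be an $n\times n$ matrix with $Q^2=A$, and let $f_1,f_2$ be $n\times h$ matrices with $$-\mathrm{i}Q(f_1-f_2)=\vartheta_1,\qquad f_1+f_2=\vartheta_2.$$ For $x\in\mathcal I_1$, $t\in\mathcal I_2$ put $$\Lambda_1(x,t)=-\mathrm{i}Q\big(\mathrm{e}^{\mathrm{i}(xQ+4tQ^3)}f_1-\mathrm{e}^{-\mathrm{i}(xQ+4tQ^3)}f_2\big),$$ $$\Lambda_2(x,t)=\mathrm{e}^{\mathrm{i}(xQ+4tQ^3)}f_1+\mathrm{e}^{-\mathrm{i}(xQ+4tQ^3)}f_2,$$ and let the $n\times n$ matrix function $S(x,t)$, with the given value $S(0,0)$ at $(0,0)$, be determined by $$\frac{\partial}{\partial x}S=\Lambda_2\Lambda_2^*,\qquad \frac{\partial}{\partial t}S=4\big(A\Lambda_2\Lambda_2^*+\Lambda_2\Lambda_2^*A^*+\Lambda_1\Lambda_1^*\big).$$ At the points of invertibility of $S(x,t)$, define the $h\times h$ matrix function $$\widetilde u(x,t)=2\big(X_{12}(x,t)+X_{21}(x,t)+X_{22}(x,t)^2\big),\qquad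 X_{ik}(x,t)=\Lambda_i(x,t)^*S(x,t)^{-1}\Lambda_k(x,t).$$ Then $\widetilde u$ satisfies (at these points) the matrix KdV equation $$\frac{\partial\widetilde u}{\partial t}-3\,\widetilde u\,\frac{\partial\widetilde u}{\partial x}-3\,\frac{\partial\widetilde u}{\partial x}\,\widetilde u+\frac{\partial^3\widetilde u}{\partial x^3}=0.$$
   Context: $n,h$ are positive integers and $m=2h$. All matrices have complex entries; $M^*$ is the conjugate transpose, $I_k$ the $k\times k$ identity matrix, $\mathrm i$ the imaginary unit, and $j=\begin{bmatrix}0&I_h\\-I_h&0\end{bmatrix}$ ($m\times m$). $\mathcal I_1,\mathcal I_2\subset\mathbb R$ are intervals containing $0$. *)

(* Defs.v *)
From HB Require Import structures.
From mathcomp Require Import all_boot all_order all_algebra.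
From mathcomp Require Import all_classical all_reals all_analysis.
From mathcomp Require Import complex.
Set Implicit Arguments.
Unset Strict Implicit.
Unset Printing Implicit Defensive.
Import Order.TTheory GRing.Theory Num.Theory.
Import numFieldNormedType.Exports.
Local Open Scope classical_set_scope.
Local Open Scope complex_scope.
Local Open Scope sesquilinear_scope.
Local Open Scope ring_scope.

(* The library only puts the norm topology on abstract [numClosedFieldType]s. *)
HB.instance Definition _ (R : realType) :=
  PseudoPointedMetric.copy R[i] (R[i] : numClosedFieldType)^o.

(* [f] has derivative [l] at [x] along the set [D]; the derivative is one-sided
   at an endpoint of an interval [D]. *)
Definition has_deriv_within (R : realType) (p q : nat) (D : set R)
    (f : R -> 'M[R[i]]_(p, q)) (x : R) (l : 'M[R[i]]_(p, q)) : Prop :=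
  (fun y : R => ((y - x)%:C)^-1 *: (f y - f x)) @ within D x^' --> l.

Definition mxexp (R : realType) (p : nat) (M : 'M[R[i]]_p) : 'M[R[i]]_p :=
  lim (series (fun k : nat => (k`!%:R : R[i])^-1 *: M ^+ k) @ \oo).

Definition jmx (R : realType) (h : nat) : 'M[R[i]]_(h + h) :=
  block_mx 0 1%:M (- 1%:M) 0.

Definition phase (R : realType) (n : nat) (Q : 'M[R[i]]_n) (x t : R) :
    'M[R[i]]_n :=
  'i%C *: (x%:C *: Q + (4 * t)%:C *: Q ^+ 3).

Definition Lambda1 (R : realType) (n h : nat) (Q : 'M[R[i]]_n)
    (f1 f2 : 'M[R[i]]_(n, h)) (x t : R) : 'M[R[i]]_(n, h) :=
  - ('i%C *: Q) *m
    (mxexp (phase Q x t) *m f1 - mxexp (- phase Q x t) *m f2).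

Definition Lambda2 (R : realType) (n h : nat) (Q : 'M[R[i]]_n)
    (f1 f2 : 'M[R[i]]_(n, h)) (x t : R) : 'M[R[i]]_(n, h) :=
  mxexp (phase Q x t) *m f1 + mxexp (- phase Q x t) *m f2.

Definition Xmx (R : realType) (n h : nat) (S : 'M[R[i]]_n)
    (Li Lk : 'M[R[i]]_(n, h)) : 'M[R[i]]_h :=
  Li ^t* *m invmx S *m Lk.

(* The values at points where [S x t] is singular are junk ([invmx]). *)
Definition utilde (R : realType) (n h : nat) (L1 L2 : R -> R -> 'M[R[i]]_(n, h))
    (S : R -> R -> 'M[R[i]]_n) (x t : R) : 'M[R[i]]_h :=
  2 *: (Xmx (S x t) (L1 x t) (L2 x t) + Xmx (S x t) (L2 x t) (L1 x t)
        + Xmx (S x t) (L2 x t) (L2 x t) ^+ 2).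

(* Main.v *)
Require Import Defs.
From HB Require Import structures.
From mathcomp Require Import all_boot all_order all_algebra.
From mathcomp Require Import all_classical all_reals all_analysis.
From mathcomp Require Import complex ring lra.
Set Implicit Arguments.
Unset Strict Implicit.
Unset Printing Implicit Defensive.
Import Order.TTheory GRing.Theory Num.Theory.
Import numFieldNormedType.Exports.
Local Open Scope classical_set_scope.
Local Open Scope complex_scope.
Local Open Scope sesquilinear_scope.
Local Open Scope ring_scope.

(** Why the theorem holds.  Write [L1], [L2] for the two Lambda functions and
   [V = S^-1].  Differentiating the exponentials gives the linear system
   [d/dx L2 = - L1], [d/dx L1 = A L2], [d/dt L2 = - 4 A L1],
   [d/dt L1 = 4 A^2 L2].  Together with the two prescribed derivatives of [S] it
   shows that [A S - S A^* - (L1 L2^* - L2 L1^* )] has zero derivative in both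
   directions; it vanishes at the origin, hence everywhere, so that
     [V A = A^* V + V (L1 L2^* - L2 L1^* ) V]
   wherever [S] is invertible.

   Call [L_i^* A^*^a V A^b L_k] a moment.  The product rule and
   [dV = - V dS V] express both partial derivatives of a moment as noncommutative
   polynomials in moments, and the displayed relation rewrites every moment as a
   polynomial in the moments with [b = 0].  The function [u] is itself such a
   polynomial, so the KdV expression is one too, and after rewriting all its
   terms cancel: KdV is an identity of free noncommutative polynomials.
   Behind the cancellation is that [v = L2^* V L2] satisfies [u = - 2 dv/dx] and
   the potential KdV equation [dv/dt = - d^3v/dx^3 - 6 (dv/dx)^2], whose
   [x]-derivative is KdV for [u].  The polynomials are represented by a syntax ([ncpoly]) on which the two
   derivations are programs, so that [kdv_utilde_normal_form] is checked by
   evaluation, and [has_deriv_eval] transports syntactic derivations to actual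
   derivatives.

   The analysis rests on a submultiplicative norm, through which limits of
   matrices become limits of nonnegative real functions: [mxnrm] turns product,
   inverse and exponential into estimates ([cvg_mxM], [cvg_invmx],
   [mxnrm_mxexp_remainder]), and the mean value theorem gives [deriv0_cst]. *)

Local Notation normc := ComplexField.Normc.normc.

(** * An entrywise l1 norm on complex matrices *)

Section MatrixNorm.
Variable R : realType.
Local Notation C := R[i].

Lemma normcR (z : C) : `|z| = (normc z)%:C. Proof. by case: z. Qed.

Lemma normc_ge0 (z : C) : 0 <= normc z.
Proof. by rewrite -lecR -normcR normr_ge0. Qed.

Lemma normc_conj (z : C) : normc (Num.conj z) = normc z.
Proof. by apply: (@complexI R); rewrite -!normcR norm_conjC. Qed.

Lemma normc_real (a : R) : normc a%:C = `|a|.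
Proof. by rewrite /= expr0n addr0 sqrtr_sqr. Qed.

Lemma normcB_sym (z w : C) : normc (z - w) = normc (w - z).
Proof. by apply: (@complexI R); rewrite -!normcR distrC. Qed.

Definition mxnrm p q (M : 'M[C]_(p, q)) : R := \sum_i \sum_j normc (M i j).

Lemma mxnrm_ge0 p q (M : 'M[C]_(p, q)) : 0 <= mxnrm M.
Proof. by do 2!apply: sumr_ge0 => ? _; apply: normc_ge0. Qed.

Lemma mxnrm0 p q : mxnrm (0 : 'M[C]_(p, q)) = 0.
Proof.
rewrite /mxnrm big1// => i _; rewrite big1// => j _.
by rewrite mxE ComplexField.Normc.normc0.
Qed.

Lemma normc_le_mxnrm p q (M : 'M[C]_(p, q)) i j : normc (M i j) <= mxnrm M.
Proof.
rewrite /mxnrm (bigD1 i)//= (bigD1 j)//= -addrA lerDl addr_ge0//.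
  by apply: sumr_ge0 => ? _; apply: normc_ge0.
by do 2!apply: sumr_ge0 => ? _; apply: normc_ge0.
Qed.

Lemma mxnrm_eq0 p q (M : 'M[C]_(p, q)) : mxnrm M <= 0 -> M = 0.
Proof.
move=> M0; apply/matrixP => i j; rewrite mxE.
apply: ComplexField.Normc.eq0_normc; apply/le_anti; rewrite normc_ge0 andbT.
exact: le_trans (normc_le_mxnrm M i j) M0.
Qed.

Lemma mxnrmD p q (M N : 'M[C]_(p, q)) : mxnrm (M + N) <= mxnrm M + mxnrm N.
Proof.
rewrite /mxnrm -big_split; apply: ler_sum => i _.
rewrite -big_split; apply: ler_sum => j _; rewrite mxE; exact: le_normcD.
Qed.

Lemma mxnrmZ p q (a : C) (M : 'M[C]_(p, q)) : mxnrm (a *: M) = normc a * mxnrm M.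
Proof.
rewrite /mxnrm mulr_sumr; apply: eq_bigr => i _; rewrite mulr_sumr.
by apply: eq_bigr => j _; rewrite mxE ComplexField.Normc.normcM.
Qed.

Lemma mxnrmN p q (M : 'M[C]_(p, q)) : mxnrm (- M) = mxnrm M.
Proof. by do 2!apply: eq_bigr => ? _; rewrite mxE normcN. Qed.

Lemma mxnrm_dist_sym p q (M N : 'M[C]_(p, q)) : mxnrm (M - N) = mxnrm (N - M).
Proof. by rewrite -opprB mxnrmN. Qed.

Lemma mxnrm_sum p q (I : Type) (r : seq I) (P : pred I) (F : I -> 'M[C]_(p, q)) :
  mxnrm (\sum_(k <- r | P k) F k) <= \sum_(k <- r | P k) mxnrm (F k).
Proof.
apply: (big_ind2 (fun M a => mxnrm M <= a)) => // [|M a N b Ma Nb].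
  by rewrite mxnrm0.
by apply: le_trans (mxnrmD M N) _; apply: lerD.
Qed.

Lemma normc_sum (I : Type) (r : seq I) (F : I -> C) :
  normc (\sum_(k <- r) F k) <= \sum_(k <- r) normc (F k).
Proof.
apply: (big_ind2 (fun x a => normc x <= a)) => // [|x a y b xa yb].
  by rewrite ComplexField.Normc.normc0.
by apply: le_trans (le_normcD x y) _; apply: lerD.
Qed.

Lemma mxnrmM p q r (M : 'M[C]_(p, q)) (N : 'M[C]_(q, r)) :
  mxnrm (M *m N) <= mxnrm M * mxnrm N.
Proof.
rewrite /mxnrm mulr_suml; apply: ler_sum => i _; rewrite mulr_suml.
under eq_bigr do rewrite mxE.
apply: (@le_trans _ _ (\sum_k \sum_j normc (M i j) * normc (N j k))).
  apply: ler_sum => k _; apply: le_trans (normc_sum _ _) _.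
  by apply: ler_sum => j _; rewrite ComplexField.Normc.normcM.
rewrite exchange_big /=; apply: ler_sum => j _.
rewrite -mulr_sumr ler_wpM2l ?normc_ge0// [leRHS](bigD1 j)//= lerDl.
by do 2!apply: sumr_ge0 => ? _; apply: normc_ge0.
Qed.

Lemma mxnrm_adj p q (M : 'M[C]_(p, q)) : mxnrm (M ^t*) = mxnrm M.
Proof.
rewrite /mxnrm exchange_big; apply: eq_bigr => i _; apply: eq_bigr => j _.
by rewrite !mxE normc_conj.
Qed.

(** The topology on matrices is the product topology on entries; this equivalence
   is what reduces every limit below to real estimates. *)
Lemma cvg_mxnrm (T : Type) (F : set_system T) (FF : Filter F) p q
    (f : T -> 'M[C]_(p, q)) (l : 'M[C]_(p, q)) :
  f @ F --> l <-> mxnrm (f y - l) @[y --> F] --> (0 : R).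
Proof.
split=> [/cvg_ballP fl|/cvgrPdist_lt fl].
  apply/cvgrPdist_le => e e0.
  pose d := e / (p * q).+1%:R.
  have d0 : 0 < d by rewrite divr_gt0.
  have /fl : (0 : C) < d%:C by rewrite ltcR.
  apply: filterS => y [_ ly].
  rewrite sub0r normrN ger0_norm ?mxnrm_ge0//.
  apply: (@le_trans _ _ (\sum_(i < p) \sum_(j < q) d)).
    apply: ler_sum => i _; apply: ler_sum => j _.
    have := ly i j; rewrite /ball /= /ball_ normcR ltcR => /ltW.
    by rewrite normcB_sym !mxE.
  rewrite !sumr_const !card_ord -mulrnA -mulr_natr mulnC /d -mulrA ler_piMr ?ltW//.
  by rewrite mulrC ltr_pdivrMr// mul1r ltr_nat.
apply/cvg_ballP => e e0.
have eE : e = (complex.Re e)%:C by rewrite RRe_real// gtr0_real.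
have /fl : 0 < complex.Re e by rewrite -ltcR -eE.
apply: filterS => y; rewrite sub0r normrN ger0_norm ?mxnrm_ge0// => yl.
split=> // i j; rewrite /ball /= /ball_ normcR eE ltcR normcB_sym.
by apply: le_lt_trans yl; have := normc_le_mxnrm (f y - l) i j; rewrite !mxE.
Qed.

Lemma cvg_mx_le (T : Type) (F : set_system T) (FF : Filter F) p q
    (f : T -> 'M[C]_(p, q)) (l : 'M[C]_(p, q)) (b : T -> R) :
  (\forall y \near F, mxnrm (f y - l) <= b y) ->
  b @ F --> (0 : R) -> f @ F --> l.
Proof.
move=> fb b0; apply/cvg_mxnrm.
apply: (@squeeze_cvgr _ _ _ _ (cst 0) b) => //; last exact: cvg_cst.
by apply: filterS fb => y ->; rewrite mxnrm_ge0.
Qed.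

End MatrixNorm.

(** * Limits and derivatives of matrix functions *)

Section MatrixLimits.
Context (R : realType) (T : Type) (F : set_system T) {FF : Filter F}.
Local Notation C := R[i].

Lemma cvg_mxD p q (f g : T -> 'M[C]_(p, q)) (a b : 'M[C]_(p, q)) :
  f @ F --> a -> g @ F --> b -> f y + g y @[y --> F] --> a + b.
Proof.
move=> /cvg_mxnrm fa /cvg_mxnrm gb.
apply: (@cvg_mx_le _ _ _ _ _ _ _ _ (fun y => mxnrm (f y - a) + mxnrm (g y - b))).
  by apply: filterE => y; rewrite opprD addrACA mxnrmD.
by rewrite -[0]addr0; apply: cvgD.
Qed.

Lemma cvg_mxM p q r (f : T -> 'M[C]_(p, q)) (g : T -> 'M[C]_(q, r))
    (a : 'M[C]_(p, q)) (b : 'M[C]_(q, r)) :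
  f @ F --> a -> g @ F --> b -> f y *m g y @[y --> F] --> a *m b.
Proof.
move=> /cvg_mxnrm fa /cvg_mxnrm gb.
apply: (@cvg_mx_le _ _ _ _ _ _ _ _ (fun y => mxnrm (f y - a) * mxnrm (g y - b)
   + mxnrm (f y - a) * mxnrm b + mxnrm a * mxnrm (g y - b))).
  apply: filterE => y.
  have -> : f y *m g y - a *m b
      = (f y - a) *m (g y - b) + (f y - a) *m b + a *m (g y - b).
    by rewrite -mulmxDr subrK mulmxBr mulmxBl addrA subrK.
  apply: le_trans (mxnrmD _ _) (lerD _ (mxnrmM _ _)).
  exact: le_trans (mxnrmD _ _) (lerD (mxnrmM _ _) (mxnrmM _ _)).
have -> : 0 = 0 * 0 + 0 * mxnrm b + mxnrm a * 0 :> R.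
  by rewrite !mulr0 mul0r !addr0.
apply: cvgD; last by apply: cvgM => //; apply: cvg_cst.
by apply: cvgD; apply: cvgM => //; apply: cvg_cst.
Qed.

Lemma cvg_mxZ p q (c : C) (f : T -> 'M[C]_(p, q)) (a : 'M[C]_(p, q)) :
  f @ F --> a -> c *: f y @[y --> F] --> c *: a.
Proof.
move=> /cvg_mxnrm fa.
apply: (@cvg_mx_le _ _ _ _ _ _ _ _ (fun y => normc c * mxnrm (f y - a))).
  by apply: filterE => y; rewrite -scalerBr mxnrmZ.
by rewrite -[0](mulr0 (normc c)); apply: cvgM => //; apply: cvg_cst.
Qed.

Lemma cvg_mx_adj p q (f : T -> 'M[C]_(p, q)) (a : 'M[C]_(p, q)) :
  f @ F --> a -> (f y) ^t* @[y --> F] --> a ^t*.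
Proof.
move=> /cvg_mxnrm fa; apply/cvg_mxnrm; apply: cvg_trans fa.
apply: near_eq_cvg; apply: filterE => y.
by rewrite -mxnrm_adj; congr mxnrm; apply/matrixP => i j; rewrite !mxE rmorphB.
Qed.

Lemma cvg_mx_near_eq p q (f g : T -> 'M[C]_(p, q)) (a : 'M[C]_(p, q)) :
  (\forall y \near F, f y = g y) -> f @ F --> a -> g @ F --> a.
Proof.
move=> fg; apply: cvg_trans; apply: near_eq_cvg.
by apply: filterS fg => y ->.
Qed.

(** The kernel matrix [K] of [f y] satisfies [K = K (a - f y) a^-1]; under the
   stated bound its norm is at most half of itself. *)
Lemma near_unitmx p (f : T -> 'M[C]_p) (a : 'M[C]_p) :
  a \in unitmx -> f @ F --> a ->
  \forall y \near F, f y \in unitmx /\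
    mxnrm (f y - a) * mxnrm (invmx a) <= 2^-1.
Proof.
move=> ua /cvg_mxnrm fa.
have /cvgrPdist_le : mxnrm (f y - a) * mxnrm (invmx a) @[y --> F] --> (0 : R).
  by rewrite -[0](mul0r (mxnrm (invmx a))); apply: cvgM => //; apply: cvg_cst.
move=> /(_ 2^-1); rewrite invr_gt0 ltr0n => /(_ isT).
apply: filterS => y.
rewrite sub0r normrN ger0_norm ?mulr_ge0 ?mxnrm_ge0// => small.
split=> //; rewrite -row_free_unit -kermx_eq0; apply/eqP/mxnrm_eq0.
set K := kermx _; have KE : K = K *m ((a - f y) *m invmx a).
  by rewrite mulmxA mulmxBr mulmx_ker subr0 mulmxK.
have : mxnrm K <= mxnrm K * 2^-1.
  rewrite {1}KE; apply: le_trans (mxnrmM _ _) (ler_wpM2l (mxnrm_ge0 _) _).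
  by apply: le_trans (mxnrmM _ _) _; rewrite mxnrm_dist_sym.
by rewrite [X in X <= _ -> _](splitr (mxnrm K)) gerDl pmulr_lle0 ?invr_gt0.
Qed.

Lemma invmxB p (M N : 'M[C]_p) : M \in unitmx -> N \in unitmx ->
  invmx M - invmx N = - (invmx M *m (M - N) *m invmx N).
Proof.
by move=> uM uN; rewrite mulmxBr mulVmx// mulmxBl mul1mx mulmxK// opprB.
Qed.

(** From [f y^-1 - a^-1 = - f y^-1 (f y - a) a^-1] the norm of [f y^-1] is
   eventually at most twice that of [a^-1], and then the same identity bounds the
   difference. *)
Lemma cvg_invmx p (f : T -> 'M[C]_p) (a : 'M[C]_p) :
  a \in unitmx -> f @ F --> a ->
  invmx (f y) @[y --> F] --> invmx a.
Proof.
move=> ua fa; set r := mxnrm (invmx a).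
apply: (@cvg_mx_le _ _ _ _ _ _ _ _ (fun y => r *+ 2 * (mxnrm (f y - a) * r))).
  apply: filterS (near_unitmx ua fa) => y [uy]; rewrite -/r => small.
  have diff : mxnrm (invmx (f y) - invmx a)
      <= mxnrm (invmx (f y)) * (mxnrm (f y - a) * r).
    rewrite invmxB// mxnrmN -mulmxA; apply: le_trans (mxnrmM _ _) _.
    by apply: ler_wpM2l; [exact: mxnrm_ge0 | exact: mxnrmM].
  apply: (le_trans diff); apply: ler_wpM2r; first by rewrite mulr_ge0 ?mxnrm_ge0.
  have : mxnrm (invmx (f y)) <= r + mxnrm (invmx (f y)) * 2^-1.
    have := mxnrmD (invmx a) (invmx (f y) - invmx a).
    rewrite addrCA subrr addr0 => /le_trans; apply; rewrite lerD2l.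
    by apply: (le_trans diff); apply: ler_wpM2l => //; apply: mxnrm_ge0.
  by move: (mxnrm (invmx (f y))) => s; lra.
have -> : 0 = r *+ 2 * (0 * r) :> R by rewrite mul0r mulr0.
apply: cvgM; first exact: cvg_cst.
by apply: cvgM; [exact/cvg_mxnrm | exact: cvg_cst].
Qed.

End MatrixLimits.

Section Derivatives.
Variables (R : realType) (D : set R).
Local Notation C := R[i].
Local Notation hasD := (has_deriv_within D).

Lemma near_neq (x : R) : \forall y \near within D x^', y != x.
Proof.
have yx : \forall y \near x^', y != x by exact: nbhs_dnbhs_neq.
by apply: cvg_within; apply: filterS yx.
Qed.

Lemma near_subC_neq0 (x : R) :
  \forall y \near within D x^', (y - x)%:C != 0 :> C.
Proof.
by apply: filterS (near_neq x) => y yx; rewrite fmorph_eq0 subr_eq0.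
Qed.

Lemma cvg_subr_within (x : R) : y - x @[y --> within D x^'] --> (0 : R).
Proof.
have : y - x @[y --> x] --> x - x.
  by apply: cvgB; [exact: cvg_id | exact: cvg_cst].
rewrite subrr; apply: cvg_trans; apply: cvg_app.
exact: cvg_trans (cvg_within _) (cvg_within _).
Qed.

Lemma cvg_dist_within (x : R) : `|y - x| @[y --> within D x^'] --> (0 : R).
Proof. by rewrite -(normr0 R); apply: cvg_norm; exact: cvg_subr_within. Qed.

Lemma has_deriv_cvg p q (f : R -> 'M[C]_(p, q)) x (l : 'M[C]_(p, q)) :
  hasD f x l -> f @ within D x^' --> f x.
Proof.
move=> /cvg_mxnrm fl.
apply: (@cvg_mx_le _ _ _ _ _ _ _ _
  (fun y => `|y - x| * (mxnrm (((y - x)%:C)^-1 *: (f y - f x) - l) + mxnrm l))).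
  apply: filterS (near_subC_neq0 x) => y yx.
  rewrite -[X in mxnrm X <= _]scale1r -(mulfV yx) -scalerA mxnrmZ normc_real.
  rewrite ler_wpM2l// -[X in mxnrm X <= _](subrK l); exact: mxnrmD.
have -> : 0 = 0 * (0 + mxnrm l) :> R by rewrite mul0r.
apply: cvgM; first exact: cvg_dist_within.
by apply: cvgD => //; apply: cvg_cst.
Qed.

End Derivatives.

Section DerivativeRules.
Variables (R : realType) (D : set R).
Local Notation C := R[i].
Local Notation hasD := (has_deriv_within D).

Lemma has_deriv_near_eq p q (f g : R -> 'M[C]_(p, q)) x (l : 'M[C]_(p, q)) :
  (\forall y \near within D x^', f y = g y) -> f x = g x ->
  hasD f x l -> hasD g x l.
Proof.
move=> fg fgx; apply: cvg_mx_near_eq.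
by apply: filterS fg => y ->; rewrite fgx.
Qed.

Lemma has_deriv_eq p q (f g : R -> 'M[C]_(p, q)) x (l l' : 'M[C]_(p, q)) :
  f =1 g -> l = l' -> hasD f x l -> hasD g x l'.
Proof. by move=> fg <-; apply: has_deriv_near_eq => //; apply: filterE. Qed.

Lemma has_deriv_cst p q (a : 'M[C]_(p, q)) x : hasD (fun=> a) x 0.
Proof.
rewrite /has_deriv_within subrr; under eq_cvg do rewrite scaler0.
exact: cvg_cst.
Qed.

Lemma has_derivD p q (f g : R -> 'M[C]_(p, q)) x (a b : 'M[C]_(p, q)) :
  hasD f x a -> hasD g x b -> hasD (fun y => f y + g y) x (a + b).
Proof.
move=> fa gb; apply: cvg_mx_near_eq (cvg_mxD fa gb).
by apply: filterE => y; rewrite -scalerDr addrACA opprD.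
Qed.

Lemma has_derivZ p q (c : C) (f : R -> 'M[C]_(p, q)) x (a : 'M[C]_(p, q)) :
  hasD f x a -> hasD (fun y => c *: f y) x (c *: a).
Proof.
move=> fa; apply: cvg_mx_near_eq (cvg_mxZ (c := c) fa).
by apply: filterE => y; rewrite -scalerBr !scalerA mulrC.
Qed.

Lemma has_derivN p q (f : R -> 'M[C]_(p, q)) x (a : 'M[C]_(p, q)) :
  hasD f x a -> hasD (fun y => - f y) x (- a).
Proof.
move=> fa; apply: has_deriv_eq (has_derivZ (c := -1) fa) => [y|].
  by rewrite scaleN1r.
by rewrite scaleN1r.
Qed.

Lemma has_derivM p q r (f : R -> 'M[C]_(p, q)) (g : R -> 'M[C]_(q, r)) x
    (a : 'M[C]_(p, q)) (b : 'M[C]_(q, r)) :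
  hasD f x a -> hasD g x b ->
  hasD (fun y => f y *m g y) x (a *m g x + f x *m b).
Proof.
move=> fa gb.
apply: cvg_mx_near_eq (cvg_mxD (cvg_mxM fa (has_deriv_cvg gb))
                               (cvg_mxM (cvg_cst (f x)) gb)).
apply: filterE => y.
by rewrite -scalemxAl -scalemxAr -scalerDr mulmxBl mulmxBr addrA subrK.
Qed.

Lemma has_derivMl p q r (a : 'M[C]_(p, q)) (g : R -> 'M[C]_(q, r)) x
    (b : 'M[C]_(q, r)) :
  hasD g x b -> hasD (fun y => a *m g y) x (a *m b).
Proof.
by move=> gb; have := has_derivM (has_deriv_cst a x) gb; rewrite mul0mx add0r.
Qed.

Lemma has_derivMr p q r (f : R -> 'M[C]_(p, q)) (b : 'M[C]_(q, r)) x
    (a : 'M[C]_(p, q)) :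
  hasD f x a -> hasD (fun y => f y *m b) x (a *m b).
Proof.
by move=> fa; have := has_derivM fa (has_deriv_cst b x); rewrite mulmx0 addr0.
Qed.

Lemma has_deriv_adj p q (f : R -> 'M[C]_(p, q)) x (a : 'M[C]_(p, q)) :
  hasD f x a -> hasD (fun y => (f y) ^t*) x (a ^t*).
Proof.
move=> fa; apply: cvg_mx_near_eq (cvg_mx_adj fa).
apply: filterE => y; apply/matrixP => i j; rewrite !mxE rmorphM.
congr (_ * _); last exact: rmorphB.
by apply: conj_Creal; rewrite rpredV; apply/complex_realP; exists (y - x).
Qed.

Lemma has_deriv_invmx p (f : R -> 'M[C]_p) x (a : 'M[C]_p) : f x \in unitmx ->
  hasD f x a ->
  hasD (fun y => invmx (f y)) x (- (invmx (f x) *m a *m invmx (f x))).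
Proof.
move=> ux fa; have fc := has_deriv_cvg fa.
rewrite -scaleN1r.
apply: cvg_mx_near_eq
  (cvg_mxZ (c := -1) (cvg_mxM (cvg_mxM (cvg_invmx ux fc) fa) (cvg_cst _))).
apply: filterS (near_unitmx ux fc) => y [uy _].
by rewrite invmxB// -scalemxAr -scalemxAl scalerN scaleN1r.
Qed.

End DerivativeRules.

(** * The matrix exponential *)

Section MatrixExponential.
Variable R : realType.
Local Notation C := R[i].

Lemma cvg_mxnrm_le (T : Type) (F : set_system T) {FF : ProperFilter F} p q
    (f : T -> 'M[C]_(p, q)) (l : 'M[C]_(p, q)) (K : R) :
  f @ F --> l -> (\forall y \near F, mxnrm (f y) <= K) -> mxnrm l <= K.
Proof.
move=> /cvg_mxnrm fl fK; rewrite leNgt; apply/negP => Kl.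
have /cvgrPdist_lt := fl => /(_ (mxnrm l - K)); rewrite subr_gt0 => /(_ Kl).
move=> /(filterI fK) /filter_ex [y [yK]].
rewrite sub0r normrN ger0_norm ?mxnrm_ge0// mxnrm_dist_sym ltNge => /negP; apply.
rewrite lerBlDr -[X in mxnrm X <= _](subrK (f y)).
by apply: le_trans (mxnrmD _ _) _; rewrite lerD2l.
Qed.

Lemma cvg_mx_unique (T : Type) (F : set_system T) {FF : ProperFilter F} p q
    (f : T -> 'M[C]_(p, q)) (a b : 'M[C]_(p, q)) :
  f @ F --> a -> f @ F --> b -> a = b.
Proof.
move=> fa fb; apply/eqP; rewrite -subr_eq0 -scaleN1r; apply/eqP/mxnrm_eq0.
apply: (cvg_mxnrm_le (cvg_mxD fa (cvg_mxZ (c := -1) fb))).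
by apply: filterE => y; rewrite scaleN1r subrr mxnrm0.
Qed.

Lemma normc_Re (z : C) : `|complex.Re z| <= normc z.
Proof. by rewrite -lecR -normcR normc_ge_Re. Qed.

Lemma normc_Im (z : C) : `|complex.Im z| <= normc z.
Proof.
case: z => a b /=; rewrite -sqrtr_sqr ler_sqrt ?addr_ge0 ?sqr_ge0//.
by rewrite lerDr sqr_ge0.
Qed.

Lemma normc_le_ReIm (z : C) : normc z <= `|complex.Re z| + `|complex.Im z|.
Proof.
case: z => a b /=; rewrite -[leRHS]ger0_norm ?addr_ge0// -sqrtr_sqr.
rewrite ler_wsqrtr// sqrrD !real_normK ?num_real// -addrA addrCA addrC.
by rewrite -addrA lerD2l lerDl mulrn_wge0// mulr_ge0.
Qed.

Lemma cvg0_sum (T : Type) (F : set_system T) {FF : Filter F} (I : Type)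
    (r : seq I) (f : I -> T -> R) :
  (forall i, f i @ F --> (0 : R)) -> \sum_(i <- r) f i y @[y --> F] --> (0 : R).
Proof.
move=> f0; elim: r => [|i r IH].
  by under eq_cvg do rewrite big_nil; apply: cvg_cst.
under eq_cvg do rewrite big_cons.
by have := cvgD (f0 i) IH; rewrite addr0; apply.
Qed.

(** Complex completeness is obtained from the absolute convergence of the real and
   imaginary parts of each entry. *)
Lemma cvg_mx_series p q (u : nat -> 'M[C]_(p, q)) (b : nat -> R) :
  (forall k, mxnrm (u k) <= b k) -> cvgn (series b) ->
  exists l : 'M[C]_(p, q), series u @ \oo --> l.
Proof.
move=> ub cb.
have part (re : C -> R) : (forall z, `|re z| <= normc z) ->
    forall i j, cvgn (series (fun k => re (u k i j))).
  move=> re_le i j; apply: normed_cvg.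
  apply: (series_le_cvg _ _ _ cb) => k //=.
    exact: le_trans (mxnrm_ge0 _) (ub k).
  exact: le_trans (le_trans (re_le _) (normc_le_mxnrm _ _ _)) (ub k).
have cRe := part _ normc_Re; have cIm := part _ normc_Im.
pose lre i j := limn (series (fun k => complex.Re (u k i j))).
pose lim_ i j := limn (series (fun k => complex.Im (u k i j))).
exists (\matrix_(i, j) (lre i j +i* lim_ i j)%C).
pose e i j N := `|series (fun k => complex.Re (u k i j)) N - lre i j|
              + `|series (fun k => complex.Im (u k i j)) N - lim_ i j|.
apply: (@cvg_mx_le _ _ _ _ _ _ _ _ (fun N => \sum_i \sum_j e i j N)).
  apply: filterE => N; apply: ler_sum => i _; apply: ler_sum => j _.
  apply: le_trans (normc_le_ReIm _) _.
  rewrite /e /series /= !mxE summxE.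
  by rewrite !raddfB/= !raddf_sum.
have dist0 (v : nat -> R) : cvgn v -> `|v N - limn v| @[N --> \oo] --> (0 : R).
  by move=> cv; rewrite -(normr0 R); apply: cvg_norm; apply/subr_cvg0.
apply: cvg0_sum => i; apply: cvg0_sum => j;
by have := cvgD (dist0 _ (cRe i j)) (dist0 _ (cIm i j)); rewrite addr0; apply.
Qed.

Lemma mxnrmX p (M : 'M[C]_p) k :
  mxnrm (M ^+ k) <= mxnrm (1 : 'M[C]_p) * mxnrm M ^+ k.
Proof.
elim: k => [|k IH]; first by rewrite !expr0 mulr1.
rewrite !exprSr mulrA; apply: le_trans (mxnrmM _ _) _.
by apply: ler_wpM2r IH; apply: mxnrm_ge0.
Qed.

Lemma normc_factV k : normc (k`!%:R^-1 : C) = (k`!%:R)^-1.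
Proof.
rewrite ComplexField.Normc.normcV; congr (_^-1).
have -> : k`!%:R = (k`!%:R)%:C :> C by rewrite rmorph_nat.
by rewrite normc_real ger0_norm.
Qed.

Lemma mxexp_cvg p (M : 'M[C]_p) :
  series (fun k : nat => (k`!%:R : C)^-1 *: M ^+ k) @ \oo --> mxexp M.
Proof.
have bound k : mxnrm ((k`!%:R : C)^-1 *: M ^+ k)
    <= (mxnrm (1 : 'M[C]_p) *: exp_coeff (mxnrm M)) k.
  rewrite mxnrmZ normc_factV mulrC.
  rewrite -[leRHS]/(mxnrm (1 : 'M[C]_p) * (mxnrm M ^+ k / k`!%:R)) mulrA.
  by apply: ler_wpM2r; [rewrite invr_ge0 ler0n | exact: mxnrmX].
have [l cl] := cvg_mx_series bound (is_cvg_seriesZ (is_cvg_series_exp_coeff _)).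
exact: (cvgP l).
Qed.


Lemma mxexp0 p : mxexp (0 : 'M[C]_p) = 1%:M.
Proof.
apply: (cvg_mx_unique (mxexp_cvg (M := 0))).
apply: (cvg_mx_near_eq (f := fun=> 1%:M)); last exact: cvg_cst.
exists 1%N => // -[//|N] _.
rewrite /series /= big_nat_recl// big1 ?addr0.
  by rewrite fact0 invr1 scale1r.
by move=> k _; rewrite expr0n scaler0.
Qed.

(** Because [M] and [H] commute, the remainder [P k] on the left satisfies
   [P (k + 1) = P k (M + H) + k H M^(k-1) H].  The factor [2 ^ k] leaves room for
   the coefficient [k]; the bound stays summable after division by [k!]. *)
Lemma mxnrm_exprD_remainder p (M H : 'M[C]_p) (b : R) k :
  GRing.comm M H -> 1 <= b -> mxnrm M + mxnrm H <= b ->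
  mxnrm ((M + H) ^+ k - M ^+ k - H * M ^+ k.-1 *+ k)
    <= (b *+ 2) ^+ k * mxnrm H ^+ 2.
Proof.
move=> MH b1 MHb; have b0 : 0 <= b by apply: le_trans b1.
have Mb : mxnrm M <= b by apply: le_trans MHb; rewrite lerDl mxnrm_ge0.
have powM j (X : 'M[C]_p) : mxnrm (M ^+ j *m X) <= b ^+ j * mxnrm X.
  elim: j => [|j IH]; first by rewrite !expr0 mul1r -[1]/(1%:M) mul1mx.
  rewrite exprS -mulmxA; apply: le_trans (mxnrmM _ _) _; rewrite exprS -mulrA.
  by apply: ler_pM => //; apply: mxnrm_ge0.
elim: k => [|k IH].
  by rewrite !expr0 subrr mulr0n subr0 mxnrm0 mul1r exprn_ge0 ?mxnrm_ge0.
set P := _ - _ in IH.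
have -> : (M + H) ^+ k.+1 - M ^+ k.+1 - H * M ^+ k *+ k.+1
        = P * (M + H) + (H * (M ^+ k.-1 * H)) *+ k.
  have ZM : H * M ^+ k.-1 *+ k * M = H * M ^+ k *+ k.
    by case: (k) => [|m]; rewrite ?mulr0n ?mul0r// mulrnAl -mulrA -exprSr.
  have YH : M ^+ k * H = H * M ^+ k by apply/esym/commrX/commr_sym.
  rewrite /P !mulrBl (mulrDr (M ^+ k)) (mulrDr (_ *+ k)) -!exprSr ZM YH.
  rewrite mulrnAl -(mulrA H) (opprD (_ *+ k)) [in RHS]addrA subrK.
  by rewrite mulrS !opprD !addrA.
apply: le_trans (mxnrmD _ _) _.
have -> : (b *+ 2) ^+ k.+1 * mxnrm H ^+ 2
    = (b *+ 2) ^+ k * mxnrm H ^+ 2 * b + (b *+ 2) ^+ k * b * mxnrm H ^+ 2.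
  by rewrite exprSr; ring.
apply: lerD.
  apply: le_trans (mxnrmM _ _) _; apply: ler_pM; rewrite ?mxnrm_ge0//.
  exact: le_trans (mxnrmD _ _) MHb.
rewrite -scaler_nat mxnrmZ.
have -> : normc (k%:R : C) = k%:R.
  by rewrite -(rmorph_nat (real_complex R)) normc_real ger0_norm.
apply: (@le_trans _ _ (k%:R * (mxnrm H * (b ^+ k.-1 * mxnrm H)))).
  apply: ler_wpM2l => //; apply: le_trans (mxnrmM _ _) _.
  by apply: ler_wpM2l; [exact: mxnrm_ge0 | exact: powM].
have -> : k%:R * (mxnrm H * (b ^+ k.-1 * mxnrm H))
    = k%:R * b ^+ k.-1 * mxnrm H ^+ 2 by ring.
apply: ler_wpM2r; first exact: exprn_ge0 (mxnrm_ge0 _).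
have -> : (b *+ 2) ^+ k * b = 2 ^+ k * b ^+ k.+1.
  by rewrite -(mulr_natl b 2) exprMn exprSr mulrA.
apply: ler_pM; rewrite ?exprn_ge0//.
  by rewrite -natrX ler_nat ltnW// ltn_expl.
by apply: ler_weXn2l => //; apply: leq_trans (leq_pred _) (leqnSn _).
Qed.

End MatrixExponential.

Section ExponentialDerivative.
Variable R : realType.
Local Notation C := R[i].

(** The exponential series converges so fast that its first-order Taylor formula
   can be proved term by term, without the addition theorem. *)
Lemma mxnrm_mxexp_remainder p (M H : 'M[C]_p) (b : R) :
  GRing.comm M H -> 1 <= b -> mxnrm M + mxnrm H <= b ->
  mxnrm (mxexp (M + H) - mxexp M - H *m mxexp M)
    <= expR (b *+ 2) * mxnrm H ^+ 2.
Proof.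
move=> MH b1 MHb; have b2_0 : 0 <= b *+ 2 by rewrite mulrn_wge0// (le_trans _ b1).
pose s (X : 'M[C]_p) := series (fun k : nat => (k`!%:R : C)^-1 *: X ^+ k).
pose P k := (M + H) ^+ k - M ^+ k - H * M ^+ k.-1 *+ k.
(* The series of [H exp M] stops one term earlier than the two others: its term
   of index [k] is the linear part of the term of index [k + 1]. *)
have sP N : s (M + H) N.+1 - s M N.+1 - H * s M N
          = \sum_(0 <= k < N.+1) (k`!%:R : C)^-1 *: P k.
  have -> : H * s M N
      = \sum_(0 <= k < N.+1) (k`!%:R : C)^-1 *: (H * M ^+ k.-1 *+ k).
    rewrite big_nat_recl//= mulr0n scaler0 add0r /s /series /= mulr_sumr.
    apply: eq_bigr => k _; rewrite factS natrM invfM.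
    rewrite -(scaler_nat k.+1 (H * _)) scalerA.
    rewrite mulrAC mulVf ?pnatr_eq0// mul1r; exact: esym (scalemxAr _ _ _).
  rewrite /s /series /= -!sumrB; apply: eq_bigr => k _.
  by rewrite -!scalerBr.
have lim_s X : s X N.+1 @[N --> \oo] --> mxexp X.
  by rewrite (cvg_shiftS (s X)); exact: mxexp_cvg.
have cvg_sP : s (M + H) N.+1 - s M N.+1 - H *m s M N @[N --> \oo]
    --> mxexp (M + H) - mxexp M - H *m mxexp M.
  have N1 (X Y Z : 'M[C]_p) : X + -1 *: Y + -1 *: Z = X - Y - Z.
    by rewrite !scaleN1r.
  rewrite -N1; under eq_cvg do rewrite -N1.
  apply: cvg_mxD; first by apply: cvg_mxD => //; apply: cvg_mxZ.
  apply: cvg_mxZ; apply: cvg_mxM; [exact: cvg_cst | exact: mxexp_cvg].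
apply: (cvg_mxnrm_le cvg_sP); apply: filterE => N.
rewrite -[_ *m _]/(H * s M N) sP; apply: le_trans (mxnrm_sum _ _ _) _.
apply: (@le_trans _ _ (series (exp_coeff (b *+ 2)) N.+1 * mxnrm H ^+ 2)).
  rewrite /series /= mulr_suml; apply: ler_sum => k _.
  rewrite mxnrmZ normc_factV mulrC -[exp_coeff _ _]/((b *+ 2) ^+ k / k`!%:R).
  rewrite mulrAC ler_wpM2r ?invr_ge0//; exact: mxnrm_exprD_remainder.
apply: ler_wpM2r; first exact: exprn_ge0 (mxnrm_ge0 _).
apply: nondecreasing_cvgn_le; last exact: is_cvg_series_exp_coeff.
apply/nondecreasing_seqP => k; rewrite /series /= big_nat_recr//= lerDl.
by rewrite divr_ge0// exprn_ge0.
Qed.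

Lemma has_deriv_mxexp (D : set R) p (g : R -> 'M[C]_p) (N : 'M[C]_p) x :
  (forall y, g y = g x + (y - x)%:C *: N) -> GRing.comm (g x) N ->
  has_deriv_within D (fun y => mxexp (g y)) x (N *m mxexp (g x)).
Proof.
move=> gE gN; pose b := mxnrm (g x) + mxnrm N + 1.
pose K := expR (b *+ 2) * mxnrm N ^+ 2.
have cdist := @cvg_dist_within _ D x.
apply: (@cvg_mx_le _ _ _ _ _ _ _ _ (fun y => `|y - x| * K)); last first.
  by have := cvgM cdist (cvg_cst K); rewrite mul0r; apply.
have near1 : \forall y \near within D x^', `|y - x| <= 1.
  have /cvgrPdist_le := cdist => /(_ 1 ltr01); apply: filterS => y.
  by rewrite sub0r normrN normr_id.
apply: filterS2 (near_subC_neq0 D x) near1 => y yx y1.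
have c0 : 0 < `|y - x|.
  by rewrite normr_gt0; apply: contraNneq yx => ->; rewrite rmorph0.
have -> : ((y - x)%:C)^-1 *: (mxexp (g y) - mxexp (g x)) - N *m mxexp (g x)
    = ((y - x)%:C)^-1 *: (mxexp (g x + (y - x)%:C *: N) - mxexp (g x)
                          - (y - x)%:C *: N *m mxexp (g x)).
  by rewrite -gE [in RHS]scalerBr -scalemxAl scalerA mulVf// scale1r.
rewrite mxnrmZ ComplexField.Normc.normcV normc_real.
rewrite mulrC ler_pdivrMr//.
have nH : mxnrm ((y - x)%:C *: N) = `|y - x| * mxnrm N.
  by rewrite mxnrmZ normc_real.
have -> : `|y - x| * K * `|y - x| = expR (b *+ 2) * mxnrm ((y - x)%:C *: N) ^+ 2.
  by rewrite nH /K; ring.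
apply: mxnrm_mxexp_remainder.
- rewrite /GRing.comm -[LHS]/(_ *m _) -[RHS]/(_ *m _).
  by rewrite -scalemxAl -scalemxAr; congr (_ *: _).
- by rewrite /b lerDr addr_ge0 ?mxnrm_ge0.
- rewrite nH /b -addrA lerD2l; apply: (@le_trans _ _ (mxnrm N)).
    by rewrite ler_piMl ?mxnrm_ge0.
  by rewrite lerDl.
Qed.

End ExponentialDerivative.

(** * Zero derivative on an interval *)

Section ZeroDerivative.
Variable R : realType.
Local Notation C := R[i].

(** The derivative along [D] is two-sided at interior points, where the mean value
   theorem needs it, and gives continuity along [D] at the endpoints.  If [D] is a
   single point there is nothing to prove. *)
Lemma real_deriv0_cst (D : set R) (g : R -> R) (a b : R) : is_interval D ->
  (forall x, D x -> (y - x)^-1 * (g y - g x) @[y --> within D x^'] --> (0 : R)) ->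
  D a -> D b -> g a = g b.
Proof.
move=> itvD g0; wlog ab : a b / a < b => [hwlog Da Db|Da Db].
  by have [ab|ba|->//] := ltgtP a b; [|symmetry]; apply: hwlog.
have Dab x : a <= x <= b -> D x by apply: itvD.
have cont x : D x -> g y @[y --> within D x^'] --> g x.
  move=> Dx; apply/subr_cvg0.
  have quotE : {near within D x^',
      (fun y => (y - x) * ((y - x)^-1 * (g y - g x))) =1 (fun y => g y - g x)}.
    by apply: filterS (near_neq D x) => y yx; rewrite mulrA mulfV ?mul1r// subr_eq0.
  apply: (cvg_trans (near_eq_cvg quotE)).
  by have := cvgM (@cvg_subr_within _ D x) (g0 x Dx); rewrite mulr0; apply.
have der x : x \in `]a, b[ -> is_derive x 1 g 0.
  rewrite in_itv/= => /andP[ax xb].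
  have Dx : D x by apply: Dab; rewrite !ltW.
  have lim0 : h^-1 *: (g (h *: 1 + x) - g x) @[h --> 0^'] --> (0 : R).
    apply: (@cvg_trans _ ((y - x)^-1 * (g y - g x) @[y --> within D x^']));
      last exact: g0.
    move=> A [/= e e0 eA].
    exists (Num.min e (Num.min (x - a) (b - x))) => /=.
      by rewrite !lt_min e0 !subr_gt0 ax xb.
    move=> h /=; rewrite sub0r normrN !lt_min => /andP[he /andP[ha hb]] h0.
    have := eA (h + x); rewrite /ball_ /= opprD addrCA subrr addr0 normrN.
    rewrite addrK [h *: 1]mulr1; apply => //.
      by rewrite -subr_eq0 addrK.
    apply: Dab; move: ha hb; rewrite !ltr_norml => /andP[h1 h2] /andP[h3 h4].
    by apply/andP; split; lra.
  by split; [apply: cvgP lim0 | apply: cvg_lim lim0].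
have [|c _] := MVT ab der; last by rewrite mul0r => /eqP; rewrite subr_eq0 => /eqP.
apply/subspace_continuousP => x /=; rewrite in_itv/= => xab.
apply/cvgrPdist_le => e e0.
have /cvgrPdist_le/(_ e e0) gx := cont x (Dab _ xab).
have {}gx : nbhs x (fun y => y != x -> D y -> `|g x - g y| <= e) := gx.
suff : nbhs x (fun y => y \in `[a, b] -> `|g x - g y| <= e) by [].
apply: filterS gx => y gy; rewrite in_itv/= => yab.
have [->|yx] := eqVneq y x; first by rewrite subrr normr0 ltW.
by apply: gy => //; apply: Dab.
Qed.

(** Reduces to [real_deriv0_cst] on the real and imaginary part of each entry. *)
Lemma deriv0_cst p q (D : set R) (f : R -> 'M[C]_(p, q)) (a b : R) :
  is_interval D -> (forall x, D x -> has_deriv_within D f x 0) ->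
  D a -> D b -> f a = f b.
Proof.
move=> itvD f0 Da Db.
have part (re : C -> R) : (forall z, `|re z| <= normc z) ->
    (forall z w, re (z - w) = re z - re w) ->
    (forall c z, re (c%:C * z) = c * re z) ->
    forall i j, re (f a i j) = re (f b i j).
  move=> re_le reB reZ i j.
  apply: (@real_deriv0_cst D (fun y => re (f y i j))) => // x Dx.
  have /cvg_mxnrm fx := f0 x Dx.
  apply/norm_cvg0P; apply: (@squeeze_cvgr _ _ _ _ (cst 0) _ _ _ _ _ fx).
    apply: filterE => y; rewrite normr_ge0 subr0 /=.
    apply: le_trans (normc_le_mxnrm _ i j).
    by rewrite !mxE -reB -reZ -fmorphV.
  exact: cvg_cst.
apply/matrixP => i j; apply/eqP; rewrite eq_complex; apply/andP; split; apply/eqP.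
  apply: part => [z|z w|c z]; first exact: normc_Re.
    exact: raddfB.
  by case: z => u v; simpc.
apply: part => [z|z w|c z]; first exact: normc_Im.
  exact: raddfB.
by case: z => u v; simpc.
Qed.

End ZeroDerivative.

(** * Derivatives of the dressing data *)

Section DressingData.
Variables (R : realType) (n h : nat) (D : set R).
Variables (Q : 'M[R[i]]_n) (f1 f2 : 'M[R[i]]_(n, h)).
Local Notation C := R[i].
Local Notation hasD := (has_deriv_within D).
Local Notation L1 := (Lambda1 Q f1 f2).
Local Notation L2 := (Lambda2 Q f1 f2).

Lemma commZ (c d : C) (M N : 'M[C]_n) :
  GRing.comm M N -> GRing.comm (c *: M) (d *: N).
Proof.
move=> MN; rewrite /GRing.comm -[LHS]/(_ *m _) -[RHS]/(_ *m _).
by rewrite -!scalemxAl -!scalemxAr [M *m N]MN scalerA mulrC -scalerA.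
Qed.

Lemma comm_phase k (c : C) x t : GRing.comm (phase Q x t) (c *: Q ^+ k).
Proof.
apply: commZ; apply/commr_sym/commrD; apply/commr_sym.
  by rewrite -[Q ^+ k]scale1r; apply: commZ; apply: commrX.
rewrite -[Q ^+ k]scale1r; apply: commZ; apply/commr_sym/commrX/commr_sym.
by apply: commrX.
Qed.

(** [Lambda2] is the case [c = 1], and [Lambda1] is [- i Q] times the case
   [c = -1]. *)
Lemma has_deriv_mxexp_comb (g : R -> 'M[C]_n) (N : 'M[C]_n) (c : C) x :
  (forall y, g y = g x + (y - x)%:C *: N) -> GRing.comm (g x) N ->
  hasD (fun y => mxexp (g y) *m f1 + c *: (mxexp (- g y) *m f2)) x
    (N *m (mxexp (g x) *m f1 - c *: (mxexp (- g x) *m f2))).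
Proof.
move=> gE gN.
have pos := has_derivMr (b := f1) (has_deriv_mxexp D gE gN).
have neg : hasD (fun y => mxexp (- g y)) x (- N *m mxexp (- g x)).
  apply: (@has_deriv_mxexp _ _ _ (fun y => - g y)) => [y|].
    by rewrite gE opprD scalerN.
  by apply: commrN; apply/commr_sym/commrN/commr_sym.
have := has_derivD pos (has_derivZ (c := c) (has_derivMr (b := f2) neg)).
by rewrite !mulNmx scalerN mulmxBr -scalemxAr !mulmxA.
Qed.

Lemma phase_x x t y : phase Q y t = phase Q x t + (y - x)%:C *: ('i%C *: Q).
Proof.
rewrite /phase; have -> : (y - x)%:C *: ('i%C *: Q) = 'i%C *: ((y - x)%:C *: Q).
  by rewrite !scalerA mulrC.
have -> : y%:C = x%:C + (y - x)%:C :> C by rewrite -rmorphD addrC subrK.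
by rewrite -scalerDr addrAC -scalerDl.
Qed.

Lemma phase_t x t s :
  phase Q x s = phase Q x t + (s - t)%:C *: ((4 * 'i%C) *: Q ^+ 3).
Proof.
rewrite /phase; have -> : (s - t)%:C *: ((4 * 'i%C) *: Q ^+ 3)
    = 'i%C *: ((4 * (s - t))%:C *: Q ^+ 3).
  by rewrite !scalerA; congr (_ *: _); rewrite rmorphM rmorph_nat; ring.
have -> : (4 * s)%:C = (4 * t)%:C + (4 * (s - t))%:C :> C.
  by rewrite -rmorphD -mulrDr addrC subrK.
by rewrite -scalerDr -addrA -scalerDl.
Qed.

Lemma comm_phase_iQ x t : GRing.comm (phase Q x t) ('i%C *: Q).
Proof. by have := comm_phase 1 'i%C x t; rewrite expr1. Qed.

Lemma Lambda2E x t :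
  L2 x t = mxexp (phase Q x t) *m f1 + 1 *: (mxexp (- phase Q x t) *m f2).
Proof. by rewrite scale1r. Qed.

Lemma Lambda1E x t : L1 x t
  = - ('i%C *: Q) *m (mxexp (phase Q x t) *m f1
                      + -1 *: (mxexp (- phase Q x t) *m f2)).
Proof. by rewrite scaleN1r. Qed.

Lemma sqr_iQ : - ('i%C *: Q) *m ('i%C *: Q) = Q ^+ 2.
Proof.
rewrite mulNmx -scalemxAl -scalemxAr scalerA -expr2 sqr_i scaleN1r opprK.
by rewrite expr2.
Qed.

Lemma Lambda2_x x t : hasD (fun y => L2 y t) x (- L1 x t).
Proof.
apply: has_deriv_eq
  (has_deriv_mxexp_comb (c := 1) (phase_x x t) (comm_phase_iQ x t)) => [y|].
  exact/esym/Lambda2E.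
by rewrite scale1r /Lambda1 mulNmx opprK.
Qed.

Lemma Lambda1_x x t : hasD (fun y => L1 y t) x (Q ^+ 2 *m L2 x t).
Proof.
apply: has_deriv_eq (has_derivMl (a := - ('i%C *: Q))
  (has_deriv_mxexp_comb (c := -1) (phase_x x t) (comm_phase_iQ x t))) => [y|].
  exact/esym/Lambda1E.
by rewrite mulmxA sqr_iQ scaleN1r opprK.
Qed.

Lemma cube_iQr : (4 * 'i%C) *: Q ^+ 3 = 4 *: (Q ^+ 2 *m ('i%C *: Q)).
Proof. by rewrite -scalemxAr exprSr scalerA. Qed.

Lemma cube_iQl : (4 * 'i%C) *: Q ^+ 3 = 4 *: (('i%C *: Q) *m Q ^+ 2).
Proof. by rewrite -scalemxAl exprS scalerA. Qed.

Lemma Lambda2_t x t : hasD (fun s => L2 x s) t (- 4 *: (Q ^+ 2 *m L1 x t)).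
Proof.
apply: has_deriv_eq
  (has_deriv_mxexp_comb (c := 1) (phase_t x t) (comm_phase 3 (4 * 'i%C) x t))
  => [s|].
  exact/esym/Lambda2E.
rewrite scale1r cube_iQr -scalemxAl -mulmxA scaleNr -scalerN.
by rewrite /Lambda1 mulNmx mulmxN opprK.
Qed.

Lemma Lambda1_t x t :
  hasD (fun s => L1 x s) t (4 *: (Q ^+ 2 *m (Q ^+ 2 *m L2 x t))).
Proof.
apply: has_deriv_eq (has_derivMl (a := - ('i%C *: Q))
  (has_deriv_mxexp_comb (c := -1) (phase_t x t) (comm_phase 3 (4 * 'i%C) x t)))
  => [s|].
  exact/esym/Lambda1E.
rewrite scaleN1r opprK cube_iQl -scalemxAl -scalemxAr -mulmxA.
by rewrite (mulmxA (- _)) sqr_iQ.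
Qed.

Lemma Lambda1_00 : L1 0 0 = - ('i%C *: Q) *m (f1 - f2).
Proof.
by rewrite /Lambda1 /phase mulr0 !scale0r addr0 scaler0 oppr0 mxexp0 !mul1mx.
Qed.

Lemma Lambda2_00 : L2 0 0 = f1 + f2.
Proof.
by rewrite /Lambda2 /phase mulr0 !scale0r addr0 scaler0 oppr0 mxexp0 !mul1mx.
Qed.

End DressingData.

(** * A free noncommutative differential algebra *)

(** [(i, a, b, k)] stands for the moment [L_i^* A^*^a S^-1 A^b L_k], where the
   booleans [false] and [true] are the indices 1 and 2. *)
Definition moment_index : Type := (bool * nat * nat * bool)%type.

Inductive ncpoly : Type :=
| Gen of moment_index
| Add of ncpoly & ncpoly
| Mul of ncpoly & ncpoly
| Scale of int & ncpoly.

Section Evaluation.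
Variables (A : pzRingType) (w : moment_index -> A).

Fixpoint nceval (e : ncpoly) : A :=
  match e with
  | Gen g => w g
  | Add e1 e2 => nceval e1 + nceval e2
  | Mul e1 e2 => nceval e1 * nceval e2
  | Scale c e1 => nceval e1 *~ c
  end.

Fixpoint ncsubst (f : moment_index -> ncpoly) (e : ncpoly) : ncpoly :=
  match e with
  | Gen g => f g
  | Add e1 e2 => Add (ncsubst f e1) (ncsubst f e2)
  | Mul e1 e2 => Mul (ncsubst f e1) (ncsubst f e2)
  | Scale c e1 => Scale c (ncsubst f e1)
  end.

Lemma nceval_subst f e :
  (forall g, nceval (f g) = w g) -> nceval (ncsubst f e) = nceval e.
Proof.
by move=> fE; elim: e => [g|e1 IH1 e2 IH2|e1 IH1 e2 IH2|c e IH] /=;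
  rewrite ?fE ?IH1 ?IH2 ?IH.
Qed.

Definition eval_word (m : seq moment_index) : A := \prod_(g <- m) w g.

Definition eval_sum (p : seq (int * seq moment_index)) : A :=
  \sum_(t <- p) eval_word t.2 *~ t.1.

(** A sum is kept as a list of coefficient-word pairs with distinct words, so that
   equal words meet and a cancelling pair disappears. *)
Fixpoint insert_term (c : int) (m : seq moment_index) p :=
  if p is (c', m') :: p' then
    if m == m' then (if c + c' == 0 then p' else (c + c', m) :: p')
    else (c', m') :: insert_term c m p'
  else [:: (c, m)].

Lemma eval_insert c m p :
  eval_sum (insert_term c m p) = eval_word m *~ c + eval_sum p.
Proof.
rewrite /eval_sum; elim: p => [|[c' m'] p IH] /=.
  by rewrite !big_cons big_nil.
case: eqP => [<-|_].
  case: eqP => [cc|_]; rewrite !big_cons /= addrA -mulrzDr ?cc//.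
  by rewrite mulr0z add0r.
by rewrite !big_cons IH addrCA.
Qed.

Fixpoint expand (e : ncpoly) : seq (int * seq moment_index) :=
  match e with
  | Gen g => [:: (1%Z, [:: g])]
  | Add e1 e2 => expand e1 ++ expand e2
  | Mul e1 e2 => [seq (s.1 * t.1, s.2 ++ t.2) | s <- expand e1, t <- expand e2]
  | Scale c e1 => [seq (c * t.1, t.2) | t <- expand e1]
  end.

Lemma eval_expand e : eval_sum (expand e) = nceval e.
Proof.
rewrite /eval_sum; elim: e => [g|e1 IH1 e2 IH2|e1 IH1 e2 IH2|c e IH] /=.
- by rewrite big_cons big_nil addr0 mulr1z /eval_word big_cons big_nil mulr1.
- by rewrite big_cat /= IH1 IH2.
- rewrite big_allpairs_dep /= -IH1 -IH2 mulr_suml; apply: eq_bigr => s _.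
  rewrite mulr_sumr; apply: eq_bigr => t _.
  by rewrite /eval_word big_cat /= mulrzAl mulrzAr -mulrzA mulrC.
- rewrite big_map -IH mulrz_suml; apply: eq_bigr => t _.
  by rewrite mulrC mulrzA.
Qed.

Definition normal_form (e : ncpoly) :=
  foldr (fun t => insert_term t.1 t.2) [::] (expand e).

Lemma normal_form_eq0 e : normal_form e = [::] -> nceval e = 0.
Proof.
move=> e0; transitivity (eval_sum (normal_form e));
  last by rewrite e0 /eval_sum big_nil.
rewrite -eval_expand /normal_form; elim: (expand e) => [|t p IH] //=.
by rewrite eval_insert -IH /eval_sum big_cons.
Qed.

End Evaluation.

Fixpoint derivation (d : moment_index -> ncpoly) (e : ncpoly) : ncpoly :=
  match e with
  | Gen g => d g
  | Add e1 e2 => Add (derivation d e1) (derivation d e2)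
  | Mul e1 e2 => Add (Mul (derivation d e1) e2) (Mul e1 (derivation d e2))
  | Scale c e1 => Scale c (derivation d e1)
  end.

(** Leibniz' rule: it suffices to know the derivatives of the generators at the one
   point [x], which matters because moments are differentiable only where [S] is
   invertible. *)
Lemma has_deriv_eval (R : realType) h (D : set R)
    (w : R -> moment_index -> 'M[R[i]]_h) (d : moment_index -> ncpoly) x :
  (forall g, has_deriv_within D (fun y => w y g) x (nceval (w x) (d g))) ->
  forall e, has_deriv_within D (fun y => nceval (w y) e) x
              (nceval (w x) (derivation d e)).
Proof.
move=> wd; elim=> [g|e1 IH1 e2 IH2|e1 IH1 e2 IH2|c e IH] /=.
- exact: wd.
- exact: has_derivD.
- exact: has_derivM.
- by apply: has_deriv_eq (has_derivZ (c := c%:~R) IH) => [y|]; rewrite scaler_int.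
Qed.

Section KdVPolynomials.
Local Notation W i a b k := (Gen (i, a, b, k)).
Local Notation "x ⊕ y" := (Add x y) (at level 50, left associativity).
Local Notation "x ⊗ y" := (Mul x y) (at level 40, left associativity).
Local Notation "c ⊙ x" := (Scale c x) (at level 30, right associativity).

(** The three groups of terms come from differentiating [L_i^*], then [L_k], then
   [S^-1] in a moment. *)
Definition dx (g : moment_index) : ncpoly :=
  let: (i, a, b, k) := g in
  (if i then (-1)%Z ⊙ W false a b k else W true a.+1 b k)
  ⊕ (if k then (-1)%Z ⊙ W i a b false else W i a b.+1 true)
  ⊕ (-1)%Z ⊙ (W i a 0 true ⊗ W true 0 b k).

Definition dt (g : moment_index) : ncpoly :=
  let: (i, a, b, k) := g in
  4%Z ⊙ ((if i then (-1)%Z ⊙ W false a.+1 b k else W true a.+2 b k)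
  ⊕ (if k then (-1)%Z ⊙ W i a b.+1 false else W i a b.+2 true)
  ⊕ (-1)%Z ⊙ (W i a 1 true ⊗ W true 0 b k ⊕ W i a 0 true ⊗ W true 1 b k
              ⊕ W i a 0 false ⊗ W false 0 b k)).

(** Rewrites a moment by [S^-1 A = A^* S^-1 + S^-1 (L1 L2^* - L2 L1^* ) S^-1] until no
   [A] is left on the right of any [S^-1]. *)
Fixpoint move_left (i : bool) (a b : nat) (k : bool) : ncpoly :=
  if b is b'.+1 then
    move_left i a.+1 b' k ⊕ W i a 0 false ⊗ move_left true 0 b' k
    ⊕ (-1)%Z ⊙ (W i a 0 true ⊗ move_left false 0 b' k)
  else W i a 0 k.

Definition utilde_poly : ncpoly :=
  2%Z ⊙ (W false 0 0 true ⊕ W true 0 0 false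
         ⊕ W true 0 0 true ⊗ W true 0 0 true).

Definition kdv (u : ncpoly) : ncpoly :=
  let ux := derivation dx u in
  derivation dt u ⊕ (-3)%Z ⊙ (u ⊗ ux) ⊕ (-3)%Z ⊙ (ux ⊗ u)
  ⊕ derivation dx (derivation dx ux).

(** The algebraic core of the theorem: after moving all [A] to the left, the KdV
   expression of [u] is zero as a free noncommutative polynomial. *)
Lemma kdv_utilde_normal_form :
  normal_form (ncsubst (fun g => let: (i, a, b, k) := g in move_left i a b k)
                     (kdv utilde_poly)) = [::].
Proof. by vm_compute. Qed.

End KdVPolynomials.

(** * The intertwining identity and the moments *)

Section Moments.
Variables (R : realType) (n h : nat).
Local Notation C := R[i].

Lemma adjM p q r (M : 'M[C]_(p, q)) (N : 'M[C]_(q, r)) :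
  (M *m N) ^t* = N ^t* *m M ^t*.
Proof. by rewrite trmx_mul map_mxM. Qed.

Lemma adjN p q (M : 'M[C]_(p, q)) : (- M) ^t* = - M ^t*.
Proof. by apply/matrixP => i j; rewrite !mxE rmorphN. Qed.

Lemma adj4 p q (M : 'M[C]_(p, q)) : (4 *: M) ^t* = 4 *: M ^t*.
Proof. by apply/matrixP => i j; rewrite !mxE rmorphM rmorph_nat. Qed.

Lemma mul_mulmx (M N : 'M[C]_h) : M * N = M *m N.
Proof. by []. Qed.

Lemma mulz_N1 (M : 'M[C]_h) : M *~ (-1)%Z = - M.
Proof. by []. Qed.

Lemma mulz_4 (M : 'M[C]_h) : M *~ 4%Z = 4 *: M.
Proof. by rewrite scaler_nat. Qed.

Variables (I1 I2 : set R) (A : 'M[C]_n).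
Variables (P L : R -> R -> 'M[C]_(n, h)) (S : R -> R -> 'M[C]_n).
Hypothesis P_x : forall x t, has_deriv_within I1 (fun y => P y t) x (A *m L x t).
Hypothesis L_x : forall x t, has_deriv_within I1 (fun y => L y t) x (- P x t).
Hypothesis P_t : forall x t,
  has_deriv_within I2 (fun s => P x s) t (4 *: (A *m (A *m L x t))).
Hypothesis L_t : forall x t,
  has_deriv_within I2 (fun s => L x s) t (- 4 *: (A *m P x t)).
Hypothesis S_x : forall x t, I1 x -> I2 t ->
  has_deriv_within I1 (fun y => S y t) x (L x t *m (L x t) ^t*).
Hypothesis S_t : forall x t, I1 x -> I2 t ->
  has_deriv_within I2 (fun s => S x s) t
    (4 *: (A *m L x t *m (L x t) ^t* + L x t *m (L x t) ^t* *m A ^t*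
           + P x t *m (P x t) ^t*)).

Definition commutator_defect x t : 'M[C]_n :=
  A *m S x t - S x t *m A ^t*
  - (P x t *m (L x t) ^t* - L x t *m (P x t) ^t*).

Lemma commutator_defect_x x t : I1 x -> I2 t ->
  has_deriv_within I1 (fun y => commutator_defect y t) x 0.
Proof.
move=> I1x I2t; have Sx := S_x I1x I2t; have Px := @P_x x t; have Lx := @L_x x t.
apply: has_deriv_eq (has_derivD (has_derivD (has_derivMl (a := A) Sx)
  (has_derivN (has_derivMr (b := A ^t*) Sx)))
  (has_derivN (has_derivD (has_derivM Px (has_deriv_adj Lx))
    (has_derivN (has_derivM Lx (has_deriv_adj Px)))))) => //.
rewrite adjM adjN !mulmxN !mulNmx !mulmxA.
set a := A *m L x t *m _; set b := L x t *m _ *m _; set c := P x t *m _.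
move: a b c => a b c.
by apply/matrixP => i j; rewrite !mxE; ring.
Qed.

Lemma commutator_defect_t x t : I1 x -> I2 t ->
  has_deriv_within I2 (fun s => commutator_defect x s) t 0.
Proof.
move=> I1x I2t; have St := S_t I1x I2t; have Pt := @P_t x t; have Lt := @L_t x t.
apply: has_deriv_eq (has_derivD (has_derivD (has_derivMl (a := A) St)
  (has_derivN (has_derivMr (b := A ^t*) St)))
  (has_derivN (has_derivD (has_derivM Pt (has_deriv_adj Lt))
    (has_derivN (has_derivM Lt (has_deriv_adj Pt)))))) => //.
rewrite !scaleNr adjN !adj4 !adjM.
rewrite !(mulmxN, mulNmx) -!(scalemxAl, scalemxAr).
rewrite !(mulmxDl, mulmxDr) !mulmxA.
set a := A *m A *m _ *m _; set b := A *m L x t *m _ *m _.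
set c := A *m P x t *m _; set d := L x t *m _ *m _ *m _; set e := P x t *m _ *m _.
move: a b c d e => a b c d e.
by apply/matrixP => i j; rewrite !mxE; ring.
Qed.

(** Join the origin to [(x, t)] by a horizontal and a vertical segment; the defect
   is constant along both. *)
Lemma intertwining x t : is_interval I1 -> is_interval I2 -> I1 0 -> I2 0 ->
  A *m S 0 0 - S 0 0 *m A ^t* = P 0 0 *m (L 0 0) ^t* - L 0 0 *m (P 0 0) ^t* ->
  I1 x -> I2 t ->
  A *m S x t - S x t *m A ^t* = P x t *m (L x t) ^t* - L x t *m (P x t) ^t*.
Proof.
move=> itv1 itv2 I10 I20 AS0 I1x I2t; apply/eqP; rewrite -subr_eq0.
rewrite -/(commutator_defect x t).
have -> : commutator_defect x t = commutator_defect 0 t.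
  apply: (deriv0_cst (f := fun y => commutator_defect y t) itv1) => // y I1y.
  exact: commutator_defect_x.
have -> : commutator_defect 0 t = commutator_defect 0 0.
  apply: (deriv0_cst (f := fun s => commutator_defect 0 s) itv2) => // s I2s.
  exact: commutator_defect_t.
by rewrite /commutator_defect AS0 subrr.
Qed.

(** The roles of [L1] and [L2] are played here by [P] and [L]. *)
Definition Lam (i : bool) x t := if i then L x t else P x t.

Definition moment x t (g : moment_index) : 'M[C]_h :=
  let: (i, a, b, k) := g in
  (Lam i x t) ^t* *m (A ^t*) ^+ a *m invmx (S x t) *m A ^+ b *m Lam k x t.

Lemma has_deriv_moment (D : set R) (F G : R -> 'M[C]_(n, h)) (T : R -> 'M[C]_n)
    z F' G' T' a b :
  has_deriv_within D F z F' -> has_deriv_within D G z G' ->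
  T z \in unitmx -> has_deriv_within D T z T' ->
  has_deriv_within D
    (fun y => (F y) ^t* *m (A ^t*) ^+ a *m invmx (T y) *m A ^+ b *m G y) z
    (F' ^t* *m (A ^t*) ^+ a *m invmx (T z) *m A ^+ b *m G z
     + (F z) ^t* *m (A ^t*) ^+ a *m invmx (T z) *m A ^+ b *m G'
     - (F z) ^t* *m (A ^t*) ^+ a *m invmx (T z) *m T' *m invmx (T z)
         *m A ^+ b *m G z).
Proof.
move=> dF dG uT dT.
apply: has_deriv_eq (has_derivM (has_derivMr (b := A ^+ b) (has_derivM
  (has_derivMr (b := (A ^t*) ^+ a) (has_deriv_adj dF))
  (has_deriv_invmx uT dT))) dG) => //.
move: (F' ^t*) ((F z) ^t*) ((A ^t*) ^+ a) (invmx _) (A ^+ b) (G z).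
move=> X' X Aa V Ab Y.
by rewrite !mulmxDl mulmxN !mulNmx !mulmxA addrAC.
Qed.

Lemma Lam_x i x t : has_deriv_within I1 (fun y => Lam i y t) x
  (if i then - P x t else A *m L x t).
Proof. by case: i; [exact: L_x | exact: P_x]. Qed.

Lemma Lam_t i x t : has_deriv_within I2 (fun s => Lam i x s) t
  (if i then - 4 *: (A *m P x t) else 4 *: (A *m (A *m L x t))).
Proof. by case: i; [exact: L_t | exact: P_t]. Qed.

Lemma moment_x x t g : I1 x -> I2 t -> S x t \in unitmx ->
  has_deriv_within I1 (fun y => moment y t g) x (nceval (moment x t) (dx g)).
Proof.
move: g => [[[i a] b] k] I1x I2t uS.
apply: has_deriv_eq (has_deriv_moment (a := a) (b := b)
  (@Lam_x i x t) (@Lam_x k x t) uS (S_x I1x I2t)) => //=.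
rewrite mulz_N1.
congr (_ + _ - _).
- case: i => /=; last by rewrite adjM exprS !mulmxA.
  by rewrite mulz_N1 adjN !mulNmx.
- case: k => /=; last by rewrite exprSr !mulmxA.
  by rewrite mulz_N1 mulmxN.
- by rewrite mul_mulmx !expr0 !mulmx1 !mulmxA.
Qed.

Lemma moment_t x t g : I1 x -> I2 t -> S x t \in unitmx ->
  has_deriv_within I2 (fun s => moment x s g) t (nceval (moment x t) (dt g)).
Proof.
move: g => [[[i a] b] k] I1x I2t uS.
apply: has_deriv_eq (has_deriv_moment (a := a) (b := b)
  (@Lam_t i x t) (@Lam_t k x t) uS (S_t I1x I2t)) => //=.
rewrite mulz_4 mulz_N1 !scalerDr scalerN; congr (_ + _ - _).
- case: i => /=.
    by rewrite mulz_N1 scaleNr adjN adj4 adjM exprS scalerN !mulNmx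
      -!scalemxAl !mulmxA.
  by rewrite adj4 !adjM !exprS -!scalemxAl !mulmxA.
- case: k => /=.
    by rewrite mulz_N1 scaleNr mulmxN scalerN -scalemxAr exprSr !mulmxA.
  by rewrite -scalemxAr !exprSr !mulmxA.
- rewrite !mul_mulmx !expr0 !expr1 !mulmx1 /=.
  move: (_ *m (A ^t*) ^+ a) (invmx _) (A ^+ b) (Lam k x t) => X V Ab Y.
  move: (A ^t*) (L x t) (P x t) => As l p.
  rewrite !(mulmxDl, mulmxDr) -!(scalemxAl, scalemxAr) !mulmxA.
  by rewrite -!scalerDr.
Qed.

(** One step multiplies the intertwining identity by [S^-1] on both sides. *)
Lemma moment_move_left x t i a b k : S x t \in unitmx ->
  A *m S x t - S x t *m A ^t* = P x t *m (L x t) ^t* - L x t *m (P x t) ^t* ->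
  nceval (moment x t) (move_left i a b k) = moment x t (i, a, b, k).
Proof.
move=> uS AS.
have RA : invmx (S x t) *m A
    = invmx (S x t) *m P x t *m (L x t) ^t* *m invmx (S x t)
      - invmx (S x t) *m L x t *m (P x t) ^t* *m invmx (S x t)
      + A ^t* *m invmx (S x t).
  have ASE : A *m S x t = P x t *m (L x t) ^t* - L x t *m (P x t) ^t*
                          + S x t *m A ^t* by rewrite -AS subrK.
  rewrite -[LHS](mulmxK uS) -(mulmxA (invmx _) A) ASE mulmxDr mulKmx// mulmxDl.
  by rewrite mulmxBr mulmxBl !mulmxA.
elim: b i a k => [//|b IH] i a k /=.
rewrite !IH /= mulz_N1 !mul_mulmx !expr0 !mulmx1 exprSr [in RHS]exprS.
rewrite -[A * _]/(A *m _) -[_ * A ^t*]/(_ *m A ^t*).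
move: ((Lam i x t) ^t*) ((A ^t*) ^+ a) (A ^+ b) (Lam k x t) RA => X Aa Ab Y.
move: (A ^t*) (invmx _) ((L x t) ^t*) ((P x t) ^t*) (L x t) (P x t).
move=> As V Ls Ps l p RA.
rewrite (mulmxA _ A Ab) -(mulmxA _ V A) RA mulmxDr !mulmxDl mulmxBr !mulmxBl.
by rewrite !mulmxA [RHS]addrC addrA.
Qed.

End Moments.

(** * The KdV equation *)

Lemma nceval_utilde (R : realType) (n h : nat) (A : 'M[R[i]]_n)
    (P L : R -> R -> 'M[R[i]]_(n, h)) (S : R -> R -> 'M[R[i]]_n) x t :
  nceval (moment A P L S x t) utilde_poly = utilde P L S x t.
Proof.
by rewrite /= -scaler_int !expr0 !mulmx1.
Qed.

Lemma row_mx_jmx (R : realType) (n h : nat) (a b : 'M[R[i]]_(n, h)) :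
  row_mx a b *m jmx R h *m (row_mx a b) ^t* = a *m b ^t* - b *m a ^t*.
Proof.
rewrite /jmx mul_row_block !mulmx0 mulmx1 mulmxN mulmx1 add0r addr0.
by rewrite tr_row_mx map_col_mx mul_row_col mulNmx addrC.
Qed.

Theorem theorem2p8 (R : realType) (n h : nat) (n_gt0 : (0 < n)%N)
    (h_gt0 : (0 < h)%N) (I1 I2 : set R)
    (itvI1 : is_interval I1) (itvI2 : is_interval I2)
    (I1_0 : I1 0) (I2_0 : I2 0)
    (A S00 : 'M[R[i]]_n) (theta1 theta2 : 'M[R[i]]_(n, h))
    (AS : A *m S00 - S00 *m A ^t*
          = row_mx theta1 theta2 *m jmx R h *m (row_mx theta1 theta2) ^t*)
    (S00_herm : S00 = S00 ^t*)
    (Q : 'M[R[i]]_n) (QA : Q ^+ 2 = A)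
    (f1 f2 : 'M[R[i]]_(n, h))
    (f1f2_1 : - ('i%C *: Q) *m (f1 - f2) = theta1)
    (f1f2_2 : f1 + f2 = theta2)
    (S : R -> R -> 'M[R[i]]_n)
    (S_0 : S 0 0 = S00) :
  let L1 := Lambda1 Q f1 f2 in
  let L2 := Lambda2 Q f1 f2 in
  let u := utilde L1 L2 S in
  (forall x t : R, I1 x -> I2 t ->
     has_deriv_within I1 (fun y => S y t) x (L2 x t *m (L2 x t) ^t*)) ->
  (forall x t : R, I1 x -> I2 t ->
     has_deriv_within I2 (fun s => S x s) t
       (4 *: (A *m L2 x t *m (L2 x t) ^t* + L2 x t *m (L2 x t) ^t* *m A ^t*
              + L1 x t *m (L1 x t) ^t*))) ->
  exists ut ux uxx uxxx : R -> R -> 'M[R[i]]_h,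
    forall x t : R, I1 x -> I2 t -> S x t \in unitmx ->
      [/\ has_deriv_within I2 (fun s => u x s) t (ut x t),
          has_deriv_within I1 (fun y => u y t) x (ux x t),
          has_deriv_within I1 (fun y => ux y t) x (uxx x t),
          has_deriv_within I1 (fun y => uxx y t) x (uxxx x t) &
          ut x t - 3 *: (u x t *m ux x t) - 3 *: (ux x t *m u x t)
            + uxxx x t = 0].
Proof.
move=> L1 L2 u S_x S_t.
have L1_x x t : has_deriv_within I1 (fun y => L1 y t) x (A *m L2 x t).
  by rewrite -QA; exact: Lambda1_x.
have L1_t x t :
    has_deriv_within I2 (fun s => L1 x s) t (4 *: (A *m (A *m L2 x t))).
  by rewrite -QA; exact: Lambda1_t.
have L2_x x t : has_deriv_within I1 (fun y => L2 y t) x (- L1 x t).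
  exact: Lambda2_x.
have L2_t x t : has_deriv_within I2 (fun s => L2 x s) t (- 4 *: (A *m L1 x t)).
  by rewrite -QA; exact: Lambda2_t.
have AS_init : A *m S 0 0 - S 0 0 *m A ^t*
    = L1 0 0 *m (L2 0 0) ^t* - L2 0 0 *m (L1 0 0) ^t*.
  by rewrite S_0 AS row_mx_jmx /L1 /L2 Lambda1_00 Lambda2_00 f1f2_1 f1f2_2.
pose w := moment A L1 L2 S; pose d e x t := nceval (w x t) e.
pose ux := derivation dx utilde_poly; pose uxx := derivation dx ux.
exists (d (derivation dt utilde_poly)), (d ux), (d uxx), (d (derivation dx uxx)).
move=> x t I1x I2t uS.
have der_x e : has_deriv_within I1 (fun y => d e y t) x (d (derivation dx e) x t).
  apply: (has_deriv_eval (w := fun y => w y t)) => g.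
  exact: (moment_x L1_x L2_x S_x).
have der_t e : has_deriv_within I2 (fun s => d e x s) t (d (derivation dt e) x t).
  apply: (has_deriv_eval (w := fun s => w x s)) => g.
  exact: (moment_t L1_t L2_t S_t).
split.
- by apply: has_deriv_eq (der_t utilde_poly) => // s; exact: nceval_utilde.
- by apply: has_deriv_eq (der_x utilde_poly) => // y; exact: nceval_utilde.
- exact: der_x.
- exact: der_x.
have AS_xt := intertwining L1_x L2_x L1_t L2_t S_x S_t itvI1 itvI2 I1_0 I2_0
  AS_init I1x I2t.
have kdv0 : nceval (w x t) (kdv utilde_poly) = 0.
  rewrite -(normal_form_eq0 (w x t) kdv_utilde_normal_form).
  apply/esym/nceval_subst => -[[[i a] b] k].
  exact: (moment_move_left i a b k uS AS_xt).
have uE : u x t = d utilde_poly x t by rewrite /d nceval_utilde.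
rewrite uE -kdv0 /kdv -/ux.
have mulz_N3 (M : 'M[R[i]]_h) : M *~ (-3)%Z = - (3 *: M) by rewrite scaler_nat.
rewrite -[RHS]/(d (derivation dt utilde_poly) x t
  + (d utilde_poly x t *m d ux x t) *~ (-3)%Z
  + (d ux x t *m d utilde_poly x t) *~ (-3)%Z + d (derivation dx uxx) x t).
by rewrite !mulz_N3.
Qed.
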